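(* Let $s\in(0,1)$, let $\Omega\subset\mathbb{R}^n$ be open and let $\{E_k\}$ be a sequence of sets that are $s$-minimal in $\Omega$ and such that $E_k\to E$ locally in measure, i.e. $|(E_k\Delta E)\cap K'|\to0$ for every compact $K'\subset\mathbb{R}^n$. Then for every compact set $K\subset\Omega$ and every $\epsilon>0$ there exists $n_0$ such that $$\partial E_k\cap K\subset N_\epsilon(\partial E)\cap K\qquad\text{for every }k\ge n_0,$$ where $N_\epsilon(\partial E)=\{x\in\mathbb{R}^n: d(x,\partial E)<\epsilon\}$.
   Context: $\mathcal{C}E$ is the complement. For disjoint measurable $A,B$, $\mathcal{L}_s(A,B):=\int_A\int_B\frac{dx\,dy}{|x-y|^{n+s}}$, and $P_s(E,\Omega):=\mathcal{L}_s(E\cap\Omega,\mathcal{C}E)+\mathcal{L}_s(E\setminus\Omega,\mathcal{C}E\cap\Omega)$. $E$ is $s$-minimal in $\Omega$ if $P_s(E,\Omega)<\infty$ and $P_s(E,\Omega)\le P_s(F,\Omega)$ for every measurable $F$ with $F\setminus\Omega=E\setminus\Omega$. Standing convention: every set $E$ is modified on a null set so that $E_1\subset E$ and $E\cap E_0=\emptyset$, where $E_1=\{x:\exists r>0,\ |E\cap B_r(x)|=\omega_nr^n\}$ and $E_0=\{x:\exists r>0,\ |E\cap B_r(x)|=0\}$, and so that $\partial E=\{x: 0<|E\cap B_r(x)|<\omega_nr^n\ \forall r>0\}$; $\omega_n=|B_1|$. *)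

(* Defs.v *)
From HB Require Import structures.
From mathcomp Require Import all_boot all_order all_algebra.
From mathcomp Require Import all_classical all_reals all_analysis.

Set Implicit Arguments.
Unset Strict Implicit.
Unset Printing Implicit Defensive.
Import Order.TTheory GRing.Theory Num.Theory.
Import numFieldNormedType.Exports.

Local Open Scope classical_set_scope.
Local Open Scope ring_scope.

(* Throughout, R^d with d >= 1 is 'rV[R]_n.+1, i.e. d = n.+1. *)

Section lebesgue_outer.
Variables (R : realType) (n : nat).
Implicit Types (a b : 'rV[R]_n.+1) (A : set 'rV[R]_n.+1).

Definition box a b : set 'rV[R]_n.+1 :=
  [set x | forall i, a ord0 i < x ord0 i <= b ord0 i].

(* If b i <= a i for some i, then box a b is empty and its volume is 0. *)
Definition box_vol a b : R := \prod_i Num.max 0 (b ord0 i - a ord0 i).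

Definition box_cover A : set (nat -> 'rV[R]_n.+1 * 'rV[R]_n.+1) :=
  [set c | A `<=` \bigcup_k box (c k).1 (c k).2].

Definition lebesgue_outer A : \bar R :=
  ereal_inf [set (\sum_(k <oo) (box_vol (c k).1 (c k).2)%:E)%E
            | c in box_cover A].

Let box_vol_ge0 a b : (0 <= (box_vol a b)%:E)%E.
Proof. by rewrite lee_fin; apply: prodr_ge0 => i _; rewrite le_max lexx. Qed.

Let lebesgue_outer_ge0 A : (0 <= lebesgue_outer A)%E.
Proof.
apply: le_ereal_inf_tmp => _ [c _ <-].
by apply: nneseries_ge0 => k _ _; exact: box_vol_ge0.
Qed.

Let lebesgue_outer0 : lebesgue_outer set0 = 0%E.
Proof.
apply/eqP; rewrite eq_le lebesgue_outer_ge0 andbT.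
apply: ereal_inf_lbound; exists (fun=> (0, 0)) => //=.
apply: eseries0 => k _ _.
by rewrite /box_vol big_ord_recl subrr maxxx mul0r.
Qed.

Let lebesgue_outer_sub A (F : (set 'rV[R]_n.+1)^nat) :
  subset_sigma_subadditive lebesgue_outer A F.
Proof.
move=> AF.
have [[i ioo]|] := pselect (exists i, lebesgue_outer (F i) = +oo%E).
  by rewrite (eseries_pinfty _ _ ioo) ?leey// => k _; rewrite -ltNye
    (lt_le_trans _ (lebesgue_outer_ge0 _)).
rewrite -forallNE => Foo.
suff add2e (e : {posnum R}) :
    (lebesgue_outer A <= \sum_(i <oo) lebesgue_outer (F i) + e%:num%:E)%E.
  by apply/lee_addgt0Pr => _/posnumP[].
rewrite (le_trans _ (epsilon_trick _ _ _))//.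
pose v (p : 'rV[R]_n.+1 * 'rV[R]_n.+1) : \bar R := (box_vol p.1 p.2)%:E.
have v0 p : (0 <= v p)%E by exact: box_vol_ge0.
pose P k c := box_cover (F k) c /\
  (\sum_(j <oo) v (c j) <=
   lebesgue_outer (F k) + (e%:num / (2 ^ k.+1)%:R)%:E)%E.
have [G PG] : {G & forall k, P k (G k)}.
  apply: (@choice _ _ P) => k.
  have en1 : 0 < e%:num / (2 ^ k.+1)%:R by [].
  have fin : lebesgue_outer (F k) \is a fin_num.
    by rewrite ge0_fin_numE// ltey; apply/eqP; exact: Foo.
  have [x [c cF cx] xS] := lb_ereal_inf_adherent en1 fin.
  by exists c; split => //; rewrite /v cx; exact/ltW.
apply: (@le_trans _ _ (\esum_(i in setT) (v \o uncurry G) i)%E).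
  apply: ereal_inf_lbound => /=.
  have /card_esym/ppcard_eqP[f] := card_nat2.
  exists (uncurry G \o f).
    move=> t /AF[i _] /(PG i).1[j _ Gij]; exists (f^-1%FUN (i, j)) => //=.
    by rewrite invK ?inE.
  rewrite -(esum_pred_image (v \o uncurry G) _ xpredT) ?[fun=> _]set_true//.
    by rewrite image_eq.
  by move=> *; exact: v0.
rewrite (_ : esum _ _ = \sum_(i <oo) \sum_(j <oo) v (G i j))%E; last first.
  pose J : nat -> set (nat * nat) := fun i => [set (i, j) | j in setT].
  rewrite (_ : setT = \bigcup_k J k); last first.
    by rewrite predeqE => -[a b]; split => // _; exists a => //; exists b.
  rewrite esum_bigcupT /=; last 2 first.
  - apply/trivIsetP => i j _ _ ij.
    rewrite predeqE => -[p m] /=; split => //= -[] [_] _ [<-{p} _].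
    by move=> [m' _] [] /esym/eqP; rewrite (negbTE ij).
  - by move=> *; exact: v0.
  rewrite -(image_id [set: nat]) -fun_true esum_pred_image//; last first.
    by move=> *; apply: esum_ge0 => *; exact: v0.
  apply: eq_eseriesr => /= j _.
  rewrite -(esum_pred_image (v \o uncurry G) (pair j) predT)//=; last first.
    by move=> ? ? _ _; exact: (@can_inj _ _ _ snd).
  by congr esum; rewrite predeqE => -[a b]; split; move=> [i _ <-]; exists i.
apply: lee_nneseries => [i _ _|i _]; last exact: (PG i).2.
by apply: nneseries_ge0 => *; exact: v0.
Qed.

HB.instance Definition _ := isSubsetOuterMeasure.Build R 'rV[R]_n.+1
  lebesgue_outer lebesgue_outer0 lebesgue_outer_ge0 lebesgue_outer_sub.

End lebesgue_outer.

(* R^n.+1 with the sigma-algebra of its Lebesgue measurable sets. *)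
Definition lebspace (R : realType) (n : nat) : measurableType _ :=
  caratheodory_type (@lebesgue_outer R n).

Definition leb {R : realType} {n : nat} : set (lebspace R n) -> \bar R :=
  @lebesgue_outer R n.
HB.instance Definition _ (R : realType) (n : nat) :=
  isMeasure.Build _ (lebspace R n) R (@leb R n)
    (@caratheodory_measure0 _ _ (@lebesgue_outer R n))
    (@caratheodory_measure_ge0 _ _ (@lebesgue_outer R n))
    (@caratheodory_measure_sigma_additive _ _ (@lebesgue_outer R n)).

Section fractional_perimeter.
Variables (R : realType) (n : nat).
Implicit Types (x y : 'rV[R]_n.+1) (A B E F Omega : set 'rV[R]_n.+1).

Definition lmeasurable A : Prop := measurable (A : set (lebspace R n)).

(* The library norm on row vectors is the sup norm, which induces the same
   topology as the Euclidean norm but different balls and kernels. *)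
Definition enorm x : R := Num.sqrt (\sum_i x ord0 i ^+ 2).

Definition eball x (r : R) : set 'rV[R]_n.+1 := [set y | enorm (y - x) < r].

(* d(x, A), equal to +oo if A is empty. *)
Definition edist x A : \bar R :=
  ereal_inf [set (enorm (x - y))%:E | y in A].

Definition nbhd (e : R) A : set 'rV[R]_n.+1 := [set x | (edist x A < e%:E)%E].

Definition bdry A : set 'rV[R]_n.+1 := closure A `\` A°.

(* |B_r| in the form omega r^(n+1), with omega = |B_1|. *)
Definition ball_vol (r : R) : \bar R :=
  (leb (eball 0 1 : set (lebspace R n)) * (r ^+ n.+1)%:E)%E.

Definition ess_int E : set 'rV[R]_n.+1 :=
  [set x | exists2 r : R, 0 < r & leb (E `&` eball x r) = ball_vol r].

Definition ess_ext E : set 'rV[R]_n.+1 :=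
  [set x | exists2 r : R, 0 < r & leb (E `&` eball x r) = 0%E].

Definition normalized E : Prop :=
  [/\ ess_int E `<=` E,
      E `&` ess_ext E = set0
    & bdry E = [set x | forall r : R, 0 < r ->
                 (0 < leb (E `&` eball x r) < ball_vol r)%E]].

Definition interaction (s : R) A B : \bar R :=
  (\int[@leb R n]_(x in A) \int[@leb R n]_(y in B)
     ((enorm (x - y) `^ (n.+1%:R + s))^-1)%:E)%E.

Definition perimeter (s : R) E Omega : \bar R :=
  (interaction s (E `&` Omega) (~` E)
   + interaction s (E `\` Omega) (~` E `&` Omega))%E.

Definition sminimal (s : R) E Omega : Prop :=
  [/\ lmeasurable E,
      (perimeter s E Omega < +oo)%E
    & forall F, lmeasurable F -> F `\` Omega = E `\` Omega ->
        (perimeter s E Omega <= perimeter s F Omega)%E].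

Definition cvg_locally_in_measure (Ek : nat -> set 'rV[R]_n.+1) E : Prop :=
  forall K, compact K ->
    leb ((Ek k `+` E) `&` K) @[k --> \oo] --> 0%E.

End fractional_perimeter.

(* Main.v *)
Require Import Defs.
From HB Require Import structures.
From mathcomp Require Import all_boot all_order all_algebra.
From mathcomp Require Import all_classical all_reals all_analysis.
From mathcomp Require Import measurable_realfun lra ring.

Set Implicit Arguments.
Unset Strict Implicit.
Unset Printing Implicit Defensive.
Import Order.TTheory GRing.Theory Num.Theory.
Import numFieldNormedType.Exports.

Local Open Scope classical_set_scope.
Local Open Scope ring_scope.

(* The uniform density estimate for s-minimal sets gives the claim: if x is in the
   boundary of E_k and B_r(x) lies in Omega, then both E_k and its complement occupy
   a volume at least delta in B_r(x), with delta depending only on n, s and r.  If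
   B_r(x) does not meet the boundary of E, it is contained in E or in its
   complement, so |(E_k + E) & B_r(x)| >= delta, which contradicts convergence in
   measure for large k.

   For the density estimate, compare E with E \ B_t: minimality gives
   L(A_t, ~A_t) <= 2 L(A_t, ~B_t) for A_t = E & B_t.  The left side is bounded below
   by an isoperimetric inequality, and the integral of the right side over
   t in ]r1, r2[ is at most C (r2 - r1)^(1-s) |E & B_r2|.  A De Giorgi iteration
   over radii decreasing from r to r/2 forces |E & B_(r/2)| = 0 if |E & B_r| is too
   small. *)

(** * Lebesgue measure: scaling, volume of balls, measurability of half-spaces *)

Section lebesgue_measure_row_vectors.
Variables (R : realType) (n : nat).
Implicit Types (x y : 'rV[R]_n.+1) (A B : set 'rV[R]_n.+1).

Lemma box_vol_ge0 x y : 0 <= box_vol x y.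
Proof. by apply: prodr_ge0 => i _; rewrite le_max lexx. Qed.

(** A homothety turns a cover by boxes into a cover by boxes, each of whose volumes is multiplied by
    t^(n+1). One inequality is enough, since the inverse homothety yields the other. *)
Lemma lebesgue_outer_affine_le x (t : R) A : 0 < t ->
  (lebesgue_outer [set (x + t *: z)%R | z in A] <=
   (t ^+ n.+1)%:E * lebesgue_outer A)%E.
Proof.
move=> t0; rewrite -lee_pdivrMl ?exprn_gt0//.
apply: le_ereal_inf_tmp => _ [c cA <-].
rewrite lee_pdivrMl ?exprn_gt0// -nneseriesZl; last first.
  by move=> k _; rewrite lee_fin box_vol_ge0.
apply: ereal_inf_lbound.
exists (fun k => (x + t *: (c k).1, x + t *: (c k).2)).
  move=> _ [z /cA[k _ zk] <-]; exists k => // i; rewrite !mxE.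
  by rewrite ltrD2l lerD2l ltr_pM2l// ler_pM2l.
apply: eq_eseriesr => k _; rewrite -EFinM; congr EFin; rewrite /box_vol.
rewrite -[X in t ^+ X]card_ord -prodr_const -big_split/=.
apply: eq_bigr => i _; rewrite !mxE.
by rewrite opprD addrACA subrr add0r -mulrBr maxr_pMr ?mulr0// ltW.
Qed.

Lemma enormZ (t : R) x : enorm (t *: x) = `|t| * enorm x.
Proof.
rewrite /enorm -sqrtr_sqr -sqrtrM ?sqr_ge0// mulr_sumr; congr Num.sqrt.
by apply: eq_bigr => i _; rewrite !mxE exprMn.
Qed.

Lemma eball_affine x (r : R) : 0 < r ->
  eball x r = [set (x + r *: z)%R | z in eball 0 1].
Proof.
move=> r0; apply/seteqP; split => [y yr|_ [z z1 <-]].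
  exists (r^-1 *: (y - x)); last by rewrite scalerA divff ?gt_eqF// scale1r addrC subrK.
  by rewrite /eball/= subr0 enormZ gtr0_norm ?invr_gt0// mulrC ltr_pdivrMr// mul1r.
move: z1; rewrite /eball/= subr0 addrAC subrr add0r enormZ gtr0_norm// => z1.
by rewrite -[ltRHS]mulr1 ltr_pM2l.
Qed.

(** The two inequalities come from the homothety that carries the unit ball to this ball and from
    its inverse. *)
Lemma leb_eball x (r : R) : 0 < r ->
  lebesgue_outer (eball x r) = @ball_vol R n r.
Proof.
move=> r0; rewrite (eball_affine x r0) /ball_vol muleC; apply/eqP; rewrite eq_le.
rewrite lebesgue_outer_affine_le//=.
have := lebesgue_outer_affine_le (- (r^-1 *: x))
  [set (x + r *: z)%R | z in eball 0 1] (eqbRL (invr_gt0 r) r0).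
rewrite -lee_pdivlMl ?exprn_gt0// -exprVn; apply: le_trans.
apply: le_outer_measure => z z1.
exists (x + r *: z); first by exists z.
by rewrite scalerDr addrA addNr add0r scalerA mulVf ?gt_eqF// scale1r.
Qed.

Lemma ler_coord_enorm x i : `|x ord0 i| <= enorm x.
Proof.
rewrite -sqrtr_sqr ler_sqrt; last by apply: sumr_ge0 => j _; exact: sqr_ge0.
by rewrite (bigD1 i)//= lerDl; apply: sumr_ge0 => j _; exact: sqr_ge0.
Qed.

Lemma lebesgue_outer_box_le x y : (lebesgue_outer (box x y) <= (box_vol x y)%:E)%E.
Proof.
apply: ereal_inf_lbound; exists (fun k => if k == 0%N then (x, y) else (0, 0)).
  by move=> z zxy; exists 0%N.
rewrite (nneseries_split 0 1)//; last first.
  by move=> k _; rewrite lee_fin box_vol_ge0.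
rewrite add0n big_nat1/= eseries0 ?adde0// => k; rewrite /= => k1 _.
by rewrite gt_eqF//= /box_vol big_ord_recl subrr maxxx mul0r.
Qed.

Lemma lebesgue_outer_eball_fin (r : R) : (lebesgue_outer (eball (0 : 'rV_n.+1) r) < +oo)%E.
Proof.
apply: (@le_lt_trans _ _ (lebesgue_outer (box (const_mx (- r)) (const_mx r)))).
  apply: le_outer_measure => y; rewrite /eball/= subr0 => yr i; rewrite !mxE.
  have := le_lt_trans (ler_coord_enorm y i) yr.
  by rewrite ltr_norml => /andP[-> /ltW].
by rewrite (le_lt_trans (lebesgue_outer_box_le _ _))// ltry.
Qed.

Lemma enorm_ge0 x : 0 <= enorm x. Proof. exact: sqrtr_ge0. Qed.

(** The hyperplane x_i = t cuts the box with corners [p.1] and [p.2] in two: [lower_cut] is the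
    upper corner of the lower piece and [upper_cut] the lower corner of the upper piece. *)
Let lower_cut i (t : R) (p : 'rV[R]_n.+1 * 'rV[R]_n.+1) : 'rV[R]_n.+1 :=
  \row_j if j == i then Num.min (p.2 ord0 j) t else p.2 ord0 j.

Let upper_cut i (t : R) (p : 'rV[R]_n.+1 * 'rV[R]_n.+1) : 'rV[R]_n.+1 :=
  \row_j if j == i then Num.max (p.1 ord0 j) t else p.1 ord0 j.

(** Only the i-th side length changes. The truncation at 0 in [box_vol] takes care of hyperplanes
    that miss the box. *)
Let box_vol_cut i t p :
  box_vol p.1 (lower_cut i t p) + box_vol (upper_cut i t p) p.2 = box_vol p.1 p.2.
Proof.
rewrite /box_vol (bigD1 i)//= [X in _ + X](bigD1 i)//= [RHS](bigD1 i)//= !mxE eqxx.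
set P := \prod_(j | _) _; set Q := \prod_(j | _) _; set S := \prod_(j | _) _.
have -> : P = S by apply: eq_bigr => j /negPf ji; rewrite !mxE ji.
have -> : Q = S by apply: eq_bigr => j /negPf ji; rewrite !mxE ji.
rewrite -mulrDl; congr (_ * _).
move: (p.1 ord0 i) (p.2 ord0 i) => a b.
by case: (leP b t) => ?; case: (leP a t) => ?; do ! case: leP => ?; lra.
Qed.

(** Caratheodory's criterion: cutting each box of a cover of X along the hyperplane gives covers of
    the two parts of X with the same total volume. *)
Lemma measurable_halfspace i (t : R) :
  lmeasurable [set x : 'rV[R]_n.+1 | x ord0 i <= t].
Proof.
apply: le_caratheodory_measurable => X.
apply: le_ereal_inf_tmp => _ [c cX <-].
pose v (p : 'rV[R]_n.+1 * 'rV[R]_n.+1) : \bar R := (box_vol p.1 p.2)%:E.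
have v0 p : (0 <= v p)%E by rewrite lee_fin box_vol_ge0.
pose c1 k := ((c k).1, lower_cut i t (c k)).
pose c2 k := (upper_cut i t (c k), (c k).2).
have -> : (\sum_(k <oo) (box_vol (c k).1 (c k).2)%:E =
  \sum_(k <oo) v (c1 k) + \sum_(k <oo) v (c2 k))%E.
  rewrite -nneseriesD//; apply: eq_eseriesr => k _.
  by rewrite -EFinD box_vol_cut.
apply: leeD; apply: ereal_inf_lbound.
  exists c1 => // z [/cX[k _ zk] /= zt]; exists k => // j.
  rewrite !mxE; case: eqP => [->|_]; last exact: zk.
  by rewrite le_min zt andbT; exact: zk.
exists c2 => // z [/cX[k _ zk] /= /negP]; rewrite -ltNge => zt; exists k => // j.
rewrite !mxE; case: eqP => [->|_]; last exact: zk.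
by rewrite gt_max zt andbT; exact: zk.
Qed.

Lemma measurable_coord i :
  measurable_fun setT (fun x : lebspace R n => (x : 'rV[R]_n.+1) ord0 i : R).
Proof.
apply: (measurability (@RGenOInfty.G R)); first exact: RGenOInfty.measurableE.
move=> _ [_ [t ->] <-]; rewrite setTI.
rewrite (_ : _ @^-1` _ = ~` [set x : 'rV[R]_n.+1 | x ord0 i <= t]).
  exact/measurableC/measurable_halfspace.
by apply/seteqP; split => x /=; rewrite in_itv/= andbT ltNge => /negP.
Qed.

End lebesgue_measure_row_vectors.

(** * Measurability of the kernel and sigma-finiteness of Lebesgue measure *)

Section kernel.
Variables (R : realType) (n : nat).
Local Notation X := (lebspace R n).
Implicit Types (x y : 'rV[R]_n.+1) (A B : set 'rV[R]_n.+1).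

Lemma measurable_enormB :
  measurable_fun setT (fun z : X * X => enorm (z.1 - z.2) : R).
Proof.
rewrite /enorm.
apply: (@measurableT_comp _ _ _ _ _ _ (@Num.sqrt R)).
  by apply: continuous_measurable_fun => x; exact: sqrt_continuous.
apply: measurable_sum => i; apply: measurable_funX.
rewrite (_ : (fun _ => _) =
  fun z : X * X => (z.1 : 'rV[R]_n.+1) ord0 i - (z.2 : 'rV[R]_n.+1) ord0 i).
  apply: measurable_funB.
    exact: (measurableT_comp (measurable_coord i) measurable_fst).
  exact: (measurableT_comp (measurable_coord i) measurable_snd).
by apply/funext => z; rewrite !mxE.
Qed.

Lemma enormC x y : enorm (x - y) = enorm (y - x).
Proof.
by congr Num.sqrt; apply: eq_bigr => i _; rewrite !mxE -sqrrN opprB.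
Qed.

Lemma measurable_dist x : measurable_fun setT (fun y : X => enorm (y - x) : R).
Proof.
have := measurableT_comp measurable_enormB
  (measurable_fun_pair (@measurable_id _ X setT) (@measurable_cst _ _ X X setT x)).
exact.
Qed.

Lemma measurable_eball x (r : R) : lmeasurable (eball x r).
Proof.
have := measurable_dist x measurableT (measurable_itv `]-oo, r[).
by rewrite setTI; congr measurable; apply/seteqP; split => y; rewrite /= in_itv.
Qed.

Lemma leb_sigma_finite : sigma_finite setT (@leb R n).
Proof.
exists (fun k => eball (0 : 'rV_n.+1) k.+1%:R).
  apply/esym/seteqP; split => // x _; exists (Num.truncn (enorm x)) => //.
  by rewrite /eball/= subr0 truncnS_gt.
by move=> k; split; [exact: measurable_eball|exact: lebesgue_outer_eball_fin].
Qed.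

End kernel.

HB.instance Definition _ (R : realType) (n : nat) :=
  Measure_isSigmaFinite.Build _ (lebspace R n) R (@leb R n) (@leb_sigma_finite R n).

Section kernel_integrals.
Variables (R : realType) (n : nat) (s : R).
Local Notation X := (lebspace R n).

(** For s > 0 the value at the origin is 0, not infinity, because 0 to a nonzero power and the
    inverse of 0 are both 0. Upper bounds are thus trivial on the diagonal, while lower bounds have
    to avoid it. *)
Definition riesz (z : 'rV[R]_n.+1) : R := (enorm z `^ (n.+1%:R + s))^-1.

Lemma riesz_ge0 z : 0 <= riesz z.
Proof. by rewrite invr_ge0 powR_ge0. Qed.

Lemma measurable_riesz : measurable_fun setT (fun z : X * X => riesz (z.1 - z.2)).
Proof.
rewrite (_ : (fun _ => _) = fun z : X * X => enorm (z.1 - z.2) `^ (- (n.+1%:R + s))).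
  exact: (measurableT_comp (measurable_powR _) (@measurable_enormB R n)).
by apply/funext => z; rewrite powRN.
Qed.

End kernel_integrals.

(** * Tonelli's theorem on measurable rectangles *)

Section tonelli_rectangles.
Local Open Scope ereal_scope.
Context d1 d2 (T1 : measurableType d1) (T2 : measurableType d2) (R : realType).
Variable m1 : {sigma_finite_measure set T1 -> \bar R}.
Variable m2 : {sigma_finite_measure set T2 -> \bar R}.
Variable f : T1 * T2 -> \bar R.
Hypotheses (mf : measurable_fun setT f) (f0 : forall z, 0 <= f z).

Lemma measurable_fun_integral_section (B : set T2) : measurable B ->
  measurable_fun setT (fun x => \int[m2]_(y in B) f (x, y)).
Proof.
move=> mB; have mTB : measurable ([set: T1] `*` B) by exact: measurableX.
have := @measurable_fun_fubini_tonelli_F _ _ _ _ _ m2 (f \_ ([set: T1] `*` B)).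
rewrite (_ : fubini_F _ _ = fun x => \int[m2]_(y in B) f (x, y)).
  apply; first by apply/(measurable_restrictT _ mTB); exact: measurable_funTS.
  by move=> z; apply: erestrict_ge0.
apply/funext => x; rewrite /fubini_F [RHS]integral_mkcond; apply: eq_integral => y _.
by rewrite /patch; congr (if _ then _ else _); apply/idP/idP; rewrite !inE => //= -[].
Qed.

(** Extending f by 0 outside the rectangle reduces this to Tonelli on the whole product. *)
Lemma fubini_tonelli_rectangle (A : set T1) (B : set T2) :
  measurable A -> measurable B ->
  \int[m1]_(x in A) \int[m2]_(y in B) f (x, y) =
  \int[m2]_(y in B) \int[m1]_(x in A) f (x, y).
Proof.
move=> mA mB; have mAB : measurable (A `*` B) by exact: measurableX.
have := @fubini_tonelli _ _ _ _ _ m1 m2 (f \_ (A `*` B)).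
have -> : (fun x => \int[m2]_y (f \_ (A `*` B)) (x, y)) =
    (fun x => \int[m2]_(y in B) f (x, y)) \_ A.
  apply/funext => x; rewrite /patch; case: ifPn; rewrite ?inE ?notin_setE => Ax.
    rewrite [RHS]integral_mkcond; apply: eq_integral => y _; rewrite /patch.
    by congr (if _ then _ else _); apply/idP/idP; rewrite !inE => //= -[].
  by apply: integral0_eq => y _; case: ifPn => //; rewrite inE => -[].
have -> : (fun y => \int[m1]_x (f \_ (A `*` B)) (x, y)) =
    (fun y => \int[m1]_(x in A) f (x, y)) \_ B.
  apply/funext => y; rewrite /patch; case: ifPn; rewrite ?inE ?notin_setE => By.
    rewrite [RHS]integral_mkcond; apply: eq_integral => x _; rewrite /patch.
    by congr (if _ then _ else _); apply/idP/idP; rewrite !inE => //= -[].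
  by apply: integral0_eq => x _; case: ifPn => //; rewrite inE => -[].
rewrite -!integral_mkcond; apply.
  by apply/(measurable_restrictT _ mAB); exact: measurable_funTS.
by move=> z; apply: erestrict_ge0.
Qed.

End tonelli_rectangles.

(** * Measurability of open sets *)

Section open_sets.
Variables (R : realType) (n : nat).

Lemma lmeasurable_box (a b : 'rV[R]_n.+1) : lmeasurable (box a b).
Proof.
rewrite /lmeasurable (_ : box a b = \bigcap_(i in [set: 'I_n.+1])
    [set x : 'rV[R]_n.+1 | x ord0 i \in `]a ord0 i, b ord0 i]]).
  apply: fin_bigcap_measurable => // i _.
  have := measurable_coord i measurableT (measurable_itv `]a ord0 i, b ord0 i]).
  by rewrite setTI.
apply/seteqP; split => x xab i; first by move=> _; rewrite /= in_itv/=; exact: xab.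
by have := xab i Logic.I; rewrite /= in_itv.
Qed.

Lemma open_lmeasurable (U : set 'rV[R]_n.+1) : open U -> lmeasurable U.
Proof.
move=> oU; pose q (u : 'rV[rat]_n.+1) : 'rV[R]_n.+1 := map_mx ratr u.
(* U is the union of the boxes with rational corners that it contains. The second factor is
   everything or empty according to whether the box lies in U, so the union can run over all pairs
   of rational points. *)
pose F (p : 'rV[rat]_n.+1 * 'rV[rat]_n.+1) :=
  box (q p.1) (q p.2) `&` [set _ | box (q p.1) (q p.2) `<=` U].
rewrite /lmeasurable (_ : U = \bigcup_p F p).
  apply: countable_bigcupT_measurable => [|p]; first exact: countableP.
  rewrite /F; have [pU|pU] := pselect (box (q p.1) (q p.2) `<=` U).
    rewrite (_ : [set _ | _] = setT) ?setIT; first exact: lmeasurable_box.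
    by apply/seteqP; split.
  by rewrite (_ : [set _ | _] = set0) ?setI0//; apply/seteqP; split.
apply/seteqP; split => [x Ux|x [p _ [xp]]]; last exact.
have /nbhs_ballP[e /= e0 xeU] : nbhs x U by exact: open_nbhs_nbhs.
have /choice[a ax] (i : 'I_n.+1) : exists r : rat, ratr r \in `]x ord0 i - e, x ord0 i[.
  by apply: rat_in_itvoo; rewrite ltrBlDr ltrDl.
have /choice[b bx] (i : 'I_n.+1) : exists r : rat, ratr r \in `]x ord0 i, x ord0 i + e[.
  by apply: rat_in_itvoo; rewrite ltrDl.
exists (\row_i a i, \row_i b i) => //; split => [i|y /= yab].
  rewrite !mxE; have := ax i; have := bx i; rewrite !in_itv/= => /andP[xb _] /andP[_ ->].
  exact: ltW.
apply: xeU; split => // i j; rewrite (ord1 i); have := yab j; rewrite !mxE => /andP[ay yb].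
have := ax j; have := bx j; rewrite !in_itv/= => /andP[_ bxe] /andP[axe _].
rewrite /ball/= ltr_norml; apply/andP; split; lra.
Qed.

End open_sets.

(** * Additivity and symmetry of the interaction, and consequences of minimality *)

Section interaction_theory.
Variables (R : realType) (n : nat) (s : R).
Implicit Types A B E F Omega : set 'rV[R]_n.+1.
Local Open Scope ereal_scope.
Local Notation X := (lebspace R n).
Local Notation L := (interaction s).

Let k (z : X * X) : \bar R := (riesz s (z.1 - z.2)%R)%:E.

Let mk : measurable_fun setT k.
Proof. by apply/measurable_EFinP; exact: measurable_riesz. Qed.

Let k0 z : 0 <= k z. Proof. by rewrite lee_fin riesz_ge0. Qed.

Let mk_section (x : X) (B : set X) : measurable_fun B (fun y : X => k (x, y)).
Proof. by apply: measurable_funTS; exact: measurableT_comp. Qed.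

Let Lk A B : L A B = \int[@leb R n]_(x in A) \int[@leb R n]_(y in B) k (x, y).
Proof. by []. Qed.

Lemma measurable_fun_riesz (x : X) :
  measurable_fun setT (fun y : X => (riesz s (x - y)%R)%:E).
Proof. exact: mk_section. Qed.

Lemma measurable_fun_riesz_integral B : lmeasurable B ->
  measurable_fun setT (fun x : X => \int[@leb R n]_(y in B) (riesz s (x - y)%R)%:E).
Proof. exact: (@measurable_fun_integral_section _ _ X X R (@leb R n) k mk k0 B). Qed.

Lemma interactionE A B : L A B =
  \int[@leb R n]_(x in A) \int[@leb R n]_(y in B) (riesz s (x - y)%R)%:E.
Proof. by []. Qed.

Lemma interaction_ge0 A B : 0 <= L A B.
Proof. by apply: integral_ge0 => x _; apply: integral_ge0 => y _; exact: (k0 (x, y)). Qed.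

Lemma interactionC A B : lmeasurable A -> lmeasurable B -> L A B = L B A.
Proof.
move=> mA mB; rewrite !Lk.
rewrite (@fubini_tonelli_rectangle _ _ X X R (@leb R n) (@leb R n) k mk k0 A B mA mB).
by apply: eq_integral => x _; apply: eq_integral => y _; rewrite /k /riesz enormC.
Qed.

Lemma interactionUl A A' B : lmeasurable A -> lmeasurable A' -> lmeasurable B ->
  A `&` A' = set0 -> L (A `|` A') B = L A B + L A' B.
Proof.
move=> mA mA' mB AA'; rewrite !Lk.
have mF := @measurable_fun_integral_section _ _ X X R (@leb R n) k mk k0 B mB.
apply: (@ge0_integral_setU _ X R (@leb R n) A A' mA mA').
- exact: measurable_funTS.
- by move=> x _; apply: integral_ge0 => y _; exact: k0.
- by apply/disj_setPS; rewrite AA'.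
Qed.

Local Opaque interaction.

Lemma interactionUr A B B' : lmeasurable A -> lmeasurable B -> lmeasurable B' ->
  B `&` B' = set0 -> L A (B `|` B') = L A B + L A B'.
Proof.
move=> mA mB mB' BB'.
by rewrite !(interactionC mA)// ?interactionUl//; exact: measurableU.
Qed.

Lemma interactionSr A B B' : lmeasurable A -> lmeasurable B -> lmeasurable B' ->
  B `<=` B' -> L A B <= L A B'.
Proof.
move=> mA mB mB' BB'; rewrite (_ : B' = B `|` (B' `\` B)); last by rewrite setDUK.
rewrite interactionUr ?leeDl ?interaction_ge0//; last exact: setDIK.
exact: measurableD.
Qed.

(** Splitting along Omega writes the perimeter as a sum of three interactions, which the exchange of
    E and its complement merely permutes. *)
Lemma perimeterC E Omega : lmeasurable E -> lmeasurable Omega ->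
  perimeter s (~` E) Omega = perimeter s E Omega.
Proof.
move=> mE mO; rewrite /perimeter setCK.
have mC B : lmeasurable B -> lmeasurable (~` B) by exact: measurableC.
have mI B B' : lmeasurable B -> lmeasurable B' -> lmeasurable (B `&` B').
  exact: measurableI.
have mD B B' : lmeasurable B -> lmeasurable B' -> lmeasurable (B `\` B').
  exact: measurableD.
rewrite -[X in L (~` E `&` Omega) X](setUIDK E Omega).
rewrite -[X in L (E `&` Omega) X](setUIDK (~` E) Omega).
have dIO B : B `&` Omega `&` (B `\` Omega) = set0.
  by apply/seteqP; split => // x [[_ ?] [_ /(_ _)]].
rewrite !interactionUr; [|auto..].
rewrite (interactionC (A := ~` E `&` Omega)); [|auto..].
rewrite (interactionC (A := ~` E `&` Omega)); [|auto..].
rewrite (interactionC (A := ~` E `\` Omega)); [|auto..].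
move: (L _ _) (L _ _) (L _ _) => a b c.
by rewrite addeAC.
Qed.

(** Through this symmetry a lower density bound for minimal sets also bounds the density of their
    complements. *)
Lemma sminimalC E Omega : lmeasurable Omega ->
  sminimal s E Omega -> sminimal s (~` E) Omega.
Proof.
move=> mO [mE PE minE]; split; [exact: measurableC|by rewrite perimeterC|].
move=> F mF FE; rewrite (perimeterC mE mO) -(perimeterC mF mO); apply: minE.
  exact: measurableC.
move/(congr1 (fun B => ~` B `\` Omega)): FE; rewrite !setDE !setCI !setCK.
by rewrite !setIUl !setICr !setU0.
Qed.

(** The competitor is E with A removed, which agrees with E outside Omega. Expanding both
    perimeters, the interactions that do not involve A occur on both sides and cancel. *)
Lemma sminimal_subset_le E Omega A : lmeasurable Omega -> sminimal s E Omega ->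
  lmeasurable A -> A `<=` E `&` Omega -> L A (~` E) <= L A (E `\` A).
Proof.
move=> mO [mE PE minE] mA AEO.
have mC B : lmeasurable B -> lmeasurable (~` B) by exact: measurableC.
have mI B B' : lmeasurable B -> lmeasurable B' -> lmeasurable (B `&` B').
  exact: measurableI.
have mU B B' : lmeasurable B -> lmeasurable B' -> lmeasurable (B `|` B').
  exact: measurableU.
have mD B B' : lmeasurable B -> lmeasurable B' -> lmeasurable (B `\` B').
  exact: measurableD.
have AE : A `<=` E by move=> x /AEO[].
have AO : A `<=` Omega by move=> x /AEO[].
have FO : (E `\` A) `\` Omega = E `\` Omega.
  by rewrite setDDl; congr (_ `\` _); exact/setUidPr.
have := minE _ (mD _ _ mE mA) FO.
move: PE; rewrite /perimeter FO.
have -> : E `&` Omega = A `|` (E `\` A) `&` Omega.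
  by rewrite (setIC (_ `\` _)) setIDA (setIC Omega) setDUK.
have -> : ~` (E `\` A) = ~` E `|` A by rewrite setDE setCI setCK.
have -> : (~` E `|` A) `&` Omega = (~` E `&` Omega) `|` A.
  by rewrite setIUl; congr (_ `|` _); exact/setIidPl.
have EA0 B : B `<=` ~` E -> B `&` A = set0.
  by move=> BE; apply/seteqP; split => // x [/BE Ex /AE].
have AG0 : A `&` ((E `\` A) `&` Omega) = set0.
  by apply/seteqP; split => // x [Ax [[]]].
have EA0' := EA0 _ (@subset_refl _ _); have EO0 := EA0 (~` E `&` Omega) (@subIsetl _ _ _).
rewrite interactionUl; [|auto..].
rewrite !interactionUr; [|auto..].
move=> PE le_PEF.
have -> : E `\` A = (E `\` A) `&` Omega `|` E `\` Omega.
  by rewrite -{1}(setUIDK (E `\` A) Omega) FO.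
rewrite interactionUr; [|auto..]; last first.
  by apply/seteqP; split => // x [[_ ?] [_ /(_ _)]].
rewrite (interactionC (A := A) (B := (E `\` A) `&` Omega)); [|auto..].
rewrite (interactionC (A := A) (B := E `\` Omega)); [|auto..].
have a0 := interaction_ge0 A (~` E).
have g0 := interaction_ge0 ((E `\` A) `&` Omega) (~` E).
have h0 := interaction_ge0 (E `\` Omega) (~` E `&` Omega).
move: (L A (~` E)) (L ((E `\` A) `&` Omega) (~` E)) (L _ (~` E `&` _))
  (L ((E `\` A) `&` Omega) A) (L (E `\` Omega) A)
  a0 g0 h0 PE le_PEF => a g h ga ha a0 g0 h0 aghoo le_agh.
(* The common terms may be subtracted because they are bounded by the perimeter of E, which is
   finite. *)
have gh : g + h \is a fin_num.
  rewrite ge0_fin_numE ?adde_ge0//; apply: le_lt_trans aghoo.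
  by rewrite -addeA leeDr.
by rewrite -(leeD2rE _ _ gh) addeA; apply: (le_trans le_agh); rewrite addeACA addeC.
Qed.

End interaction_theory.

(** * The triangle inequality for the Euclidean norm *)

Section euclidean_norm.
Variables (R : realType) (n : nat).
Implicit Types x y z : 'rV[R]_n.+1.

Lemma enorm_eq0 x : enorm x = 0 -> x = 0.
Proof.
move=> x0; apply/rowP => i; rewrite !mxE; apply/eqP; rewrite -normr_le0.
by rewrite -x0 ler_coord_enorm.
Qed.

Lemma sqr_enorm x : enorm x ^+ 2 = \sum_i x ord0 i ^+ 2.
Proof. by rewrite sqr_sqrtr// sumr_ge0// => i _; exact: sqr_ge0. Qed.

Lemma enorm_triangle x y : enorm (x + y) <= enorm x + enorm y.
Proof.
have [/enorm_eq0->|x0] := eqVneq (enorm x) 0; first by rewrite add0r lerDr enorm_ge0.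
have [/enorm_eq0->|y0] := eqVneq (enorm y) 0; first by rewrite addr0 lerDl enorm_ge0.
set a := enorm x; set b := enorm y.
have a0 : 0 < a by rewrite lt_neqAle eq_sym x0 enorm_ge0.
have b0 : 0 < b by rewrite lt_neqAle eq_sym y0 enorm_ge0.
pose c := \sum_i x ord0 i * y ord0 i.
(* The sum equals 2ab(ab - c), so its sign is the Cauchy-Schwarz inequality c <= ab. *)
have : 0 <= \sum_i (b * x ord0 i - a * y ord0 i) ^+ 2.
  by apply: sumr_ge0 => i _; exact: sqr_ge0.
have -> : \sum_i (b * x ord0 i - a * y ord0 i) ^+ 2 =
    b ^+ 2 * a ^+ 2 + a ^+ 2 * b ^+ 2 - 2 * (a * b) * c.
  transitivity (\sum_i (b ^+ 2 * x ord0 i ^+ 2 +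
      (a ^+ 2 * y ord0 i ^+ 2 - 2 * (a * b) * (x ord0 i * y ord0 i)))).
    by apply: eq_bigr => i _; ring.
  by rewrite !big_split/= sumrN -!mulr_sumr -!sqr_enorm addrA.
move=> cab; have {}cab : c <= a * b.
  have ab0 : 0 < a * b by rewrite mulr_gt0.
  by rewrite -(ler_pM2l ab0); lra.
rewrite -ler_sqr ?nnegrE ?addr_ge0 ?enorm_ge0// sqr_enorm.
have -> : \sum_i (x + y) ord0 i ^+ 2 = a ^+ 2 + b ^+ 2 + 2 * c.
  rewrite !sqr_enorm mulr_sumr -!big_split/=.
  by apply: eq_bigr => i _; rewrite mxE; ring.
rewrite sqrrD; lra.
Qed.

Lemma enorm_dist x y z : enorm (y - z) <= enorm (x - z) + enorm (x - y).
Proof.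
have -> : y - z = (x - z) + (y - x) by rewrite [RHS]addrC addrA subrK.
by rewrite (enormC x y) enorm_triangle.
Qed.

End euclidean_norm.

(** * Isoperimetric lower bound and dyadic tools *)

Section kernel_estimates.
Variables (R : realType) (n : nat) (s : R).
Hypothesis s0 : 0 < s.
Implicit Types A : set 'rV[R]_n.+1.
Local Notation X := (lebspace R n).
Local Notation L := (interaction s).
Local Notation d := n.+1.

Definition unit_ball_vol : R := fine (@lebesgue_outer R n (eball 0 1)).
Local Notation V := unit_ball_vol.

Lemma unit_ball_vol_ge0 : 0 <= V.
Proof. by rewrite fine_ge0// outer_measure_ge0. Qed.

Lemma leb_eballE x (r : R) : 0 < r -> @leb R n (eball x r) = (V * r ^+ d)%:E.
Proof.
move=> r0; rewrite /leb leb_eball// /ball_vol EFinM /V fineK//.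
by rewrite ge0_fin_numE ?outer_measure_ge0// lebesgue_outer_eball_fin.
Qed.

Let p0 : 0 < d%:R + s. Proof. by rewrite addr_gt0. Qed.

Lemma riesz_ge (z : 'rV[R]_n.+1) (r : R) : z != 0 -> enorm z <= r ->
  (r `^ (d%:R + s))^-1 <= riesz s z.
Proof.
move=> z0 zr; have ez : 0 < enorm z.
  by rewrite lt_neqAle enorm_ge0 andbT eq_sym; apply: contra_neq z0 => /enorm_eq0.
have r0 := lt_le_trans ez zr.
rewrite lef_pV2 ?posrE ?powR_gt0//.
by rewrite ge0_ler_powR ?nnegrE// ltW.
Qed.

(* The ball of radius [rho] around a point of [A] has at least half of its volume
   outside [A], so no rearrangement is needed for this isoperimetric bound. *)
Lemma interaction_compl_ge A (rho : R) : lmeasurable A -> 0 < rho ->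
  (leb (A : set X) <= (V / 2 * rho ^+ d)%:E)%E ->
  ((V / 2 * rho `^ (- s))%:E * leb (A : set X) <= L A (~` A))%E.
Proof.
move=> mA rho0 A_small.
rewrite interactionE -(@integral_cst _ X R (@leb R n) A mA).
apply: (@ge0_le_integral _ X R (@leb R n) A mA).
- by move=> x _; rewrite lee_fin mulr_ge0 ?divr_ge0 ?unit_ball_vol_ge0 ?powR_ge0.
- exact: measurable_cst.
- apply: measurable_funTS.
  apply: (@measurable_fun_riesz_integral R n s (~` A)); exact: measurableC.
move=> x Ax.
have mBA : lmeasurable (eball x rho `\` A).
  by apply: measurableD => //; exact: measurable_eball.
(* On the ball minus A the kernel is at least rho^-(d+s), and this set has measure at least V / 2 *
   rho^d. The product is the constant V / 2 * rho^-s of the statement. *)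
apply: (@le_trans _ _ (\int[@leb R n]_(y in eball x rho `\` A)
    cst ((rho `^ (d%:R + s))^-1)%:E y)%E); last first.
  apply: (@le_trans _ _ (\int[@leb R n]_(y in eball x rho `\` A) (riesz s (x - y))%:E)%E).
    apply: (@ge0_le_integral _ X R (@leb R n) (eball x rho `\` A) mBA).
    - by move=> y _; rewrite lee_fin invr_ge0 powR_ge0.
    - exact: measurable_cst.
    - exact/measurable_funTS/measurable_fun_riesz.
    - move=> y [xy Ay]; rewrite lee_fin riesz_ge//; last by rewrite enormC ltW.
      by rewrite subr_eq0; apply: contra_notN Ay => /eqP<-.
  apply: (@ge0_subset_integral _ X R (@leb R n) (eball x rho `\` A) (~` A) mBA).
  - exact: measurableC.
  - exact/measurable_funTS/measurable_fun_riesz.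
  - by move=> y _; rewrite lee_fin riesz_ge0.
  - by move=> y [].
rewrite (@integral_cst _ X R (@leb R n) (eball x rho `\` A) mBA).
have : (leb (eball x rho : set X) <= leb (A : set X) + leb (eball x rho `\` A : set X))%E.
  rewrite -[X in leb X](setUIDK (eball x rho) A).
  apply: le_trans (outer_measureU2 (@lebesgue_outer R n) _ _) _.
  by apply: leeD => //; apply: le_outer_measure.
rewrite leb_eballE// => BA.
have {BA} BA : ((V / 2 * rho ^+ d)%:E <= leb (eball x rho `\` A : set X))%E.
  have := le_trans BA (leeD2r _ A_small).
  by rewrite -leeBlDl//; apply: le_trans; rewrite -EFinB lee_fin; lra.
have := lee_wpmul2l _ BA; move=> /(_ ((rho `^ (d%:R + s))^-1)%:E).
rewrite lee_fin invr_ge0 powR_ge0 => /(_ isT); apply: le_trans.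
rewrite -EFinM lee_fin powRD ?gt_eqF ?implybT// (powR_mulrn _ (ltW rho0)) powRN.
have rho_d : rho ^+ d != 0 by rewrite expf_neq0 ?gt_eqF.
have rho_s : rho `^ s != 0 by rewrite gt_eqF ?powR_gt0.
move: (rho ^+ d) (rho `^ s) rho_d rho_s => u v u0 v0.
rewrite le_eqVlt; apply/orP; left; apply/eqP; field.
by rewrite u0 v0.
Qed.

Lemma nneseries_geometric (c q : R) : 0 <= q < 1 ->
  (\sum_(j <oo) (c * q ^+ j)%:E)%E = (c / (1 - q))%:E.
Proof.
move=> /andP[q0 q1]; apply/cvg_lim => //.
rewrite (_ : (fun _ => _) = EFin \o series (geometric c q)).
  apply: cvg_EFin; first by near=> k.
  by apply: cvg_geometric_series; rewrite ger0_norm.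
by apply/funext => k /=; rewrite -sumEFin.
Unshelve. all: by end_near. Qed.

Lemma dyadic_scale (u : R) : 1 <= u -> exists j, 2 ^+ j <= u < 2 ^+ j.+1.
Proof.
move=> u1; exists (trunc_log 2 (Num.truncn u)).
have tu : (0 < Num.truncn u)%N by rewrite truncn_gt0.
have /andP[le_tu lt_tu] := @trunc_log_bounds 2 _ isT tu.
rewrite -!natrX; apply/andP; split.
  by rewrite -truncn_ge_nat// (le_trans ler01).
by rewrite (lt_le_trans (truncnS_gt _))// ler_nat.
Qed.

End kernel_estimates.

(** * Integral of the kernel against a truncated distance *)

Section kernel_moment.
Variables (R : realType) (n : nat) (s : R).
Hypothesis s01 : 0 < s < 1.
Local Notation X := (lebspace R n).
Local Notation d := n.+1.
Local Notation V := (unit_ball_vol R n).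

Let s0 : 0 < s. Proof. by case/andP: s01. Qed.
Let s1 : s < 1. Proof. by case/andP: s01. Qed.
Let p0 : 0 < d%:R + s. Proof. by rewrite addr_gt0. Qed.

(** Ratios of the two geometric series: q < 1 because s < 1, which gives integrability near the
    diagonal, and q' < 1 because s > 0, which gives integrability at infinity. *)
Let q : R := 2^-1 `^ (1 - s).
Let q' : R := 2 `^ (- s).

Let q01 : 0 <= q < 1.
Proof.
rewrite powR_ge0/= -[ltRHS](congr1 (fun f => f (1 - s)) (powR1 R)).
by apply: gt0_ltr_powR; rewrite ?nnegrE ?subr_gt0 ?invr_ge0 ?invf_lt1 ?ltr1n.
Qed.

Let q'01 : 0 <= q' < 1.
Proof.
rewrite powR_ge0/= /q' powRN invf_lt1 ?powR_gt0//.
rewrite -[ltLHS](congr1 (fun f => f s) (powR1 R)).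
by apply: gt0_ltr_powR; rewrite ?nnegrE ?ltr1n.
Qed.

(* The two geometric sums come from the dyadic shells inside and outside the
   ball of radius [a] in [riesz_min_integral_le]. *)
Definition moment_const : R :=
  V * 4 ^+ d * 2^-1 `^ (1 - s) / (1 - 2^-1 `^ (1 - s)) +
  V * 2 ^+ d / (1 - 2 `^ (- s)).

(** Upper bounds for the integrand on the shells a / 2^(j+1) < |x - y| <= a / 2^j (near) and 2^j a
    <= |x - y| < 2^(j+1) a (far). The decreasing power is evaluated at the inner radius, and the
    shell is enlarged to an open ball that contains it. *)
Let near_term (a : R) (j : nat) (x y : 'rV[R]_n.+1) : R :=
  (a / 2 ^+ j.+1) `^ (1 - (d%:R + s)) * \1_(eball x (2 * (a / 2 ^+ j))) y.

Let far_term (a : R) (j : nat) (x y : 'rV[R]_n.+1) : R :=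
  a * (2 ^+ j * a) `^ (- (d%:R + s)) * \1_(eball x (2 * (2 ^+ j * a))) y.

Let near_term_ge0 a j x y : 0 <= near_term a j x y.
Proof. by rewrite mulr_ge0 ?powR_ge0. Qed.

Let far_term_ge0 a j x y : 0 <= a -> 0 <= far_term a j x y.
Proof. by move=> a0; rewrite !mulr_ge0 ?powR_ge0. Qed.

Let pow2 (j : nat) : 0 < 2 ^+ j :> R. Proof. by rewrite exprn_gt0. Qed.

Let riesz_min_le_terms (a : R) x y : 0 < a ->
  exists j, riesz s (x - y) * Num.min (enorm (x - y)) a <=
    near_term a j x y + far_term a j x y.
Proof.
move=> a0; set t := enorm (x - y).
(* On the diagonal the kernel has the value 0, so any index will do. *)
have [t0|t0] := eqVneq t 0.
  exists 0%N; rewrite /riesz -/t t0 powR0 ?gt_eqF// invr0 mul0r.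
  by rewrite addr_ge0 ?near_term_ge0 ?far_term_ge0// ltW.
have {}t0 : 0 < t by rewrite lt_neqAle eq_sym t0 enorm_ge0.
have [ta|at_] := ltP t a.
  have /dyadic_scale[j /andP[lj uj]] : 1 <= a / t by rewrite ler_pdivlMr// mul1r ltW.
  exists j; apply: ler_wpDr; first by rewrite far_term_ge0// ltW.
  rewrite /near_term indicE mem_set; last first.
    rewrite /eball/= enormC -/t (@le_lt_trans _ _ (a / 2 ^+ j))//.
      by rewrite ler_pdivlMr// mulrC -ler_pdivlMr.
    by rewrite ltr_pMl ?divr_gt0// ltr1n.
  have p1 : 0 < d%:R + s - 1.
    by rewrite subr_gt0 (@lt_le_trans _ _ (1 + s)) ?ltrDl// lerD2r ler1n.
  have -> : riesz s (x - y) * t = (t `^ (d%:R + s - 1))^-1.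
    have tn0 : t != 0 by rewrite gt_eqF.
    rewrite /riesz -/t (@powRB _ t (d%:R + s) 1) ?tn0 ?implybT// (powRr1 (ltW t0)).
    by rewrite invf_div mulrC.
  rewrite mulr1 -[1 - _]opprB powRN lef_pV2 ?posrE ?powR_gt0 ?divr_gt0//.
  apply: ge0_ler_powR; rewrite ?nnegrE; [exact: ltW|exact/ltW/divr_gt0|exact: ltW|].
  by apply: ltW; rewrite ltr_pdivrMr// mulrC -ltr_pdivrMr.
have /dyadic_scale[j /andP[lj uj]] : 1 <= t / a by rewrite ler_pdivlMr// mul1r.
exists j; apply: ler_wpDl; first exact: near_term_ge0.
rewrite /far_term indicE mem_set; last first.
  by rewrite /eball/= enormC -/t mulrA -exprS -ltr_pdivrMr.
rewrite mulr1 mulrC /riesz -/t ler_pM2l//.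
rewrite powRN lef_pV2 ?posrE ?powR_gt0 ?mulr_gt0//.
apply: ge0_ler_powR; rewrite ?nnegrE -?ler_pdivlMr//; [exact: ltW| |exact: ltW].
by rewrite mulr_ge0 ?ltW.
Qed.

Let m_indic x (r : R) : measurable_fun setT (fun y : X => (\1_(eball x r) y : R)).
Proof. by apply: measurable_indic; exact: measurable_eball. Qed.

Let integral_indic_eball x (r c : R) : 0 <= c -> 0 < r ->
  (\int[@leb R n]_y (c * \1_(eball x r) (y : X))%:E = (c * (V * r ^+ d))%:E)%E.
Proof.
move=> c0 r0; under eq_integral do rewrite EFinM.
have m1 : measurable_fun setT (fun y : X => (\1_(eball x r) y)%:E : \bar R).
  by apply/measurable_EFinP; exact: m_indic.
rewrite (@ge0_integralZl _ X R (@leb R n) _ measurableT _ m1).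
- rewrite integral_indic; [|exact: measurableT|exact: measurable_eball].
  by rewrite setIT EFinM; congr (_ * _)%E; exact: leb_eballE.
- by move=> y _; rewrite lee_fin.
- by rewrite lee_fin.
Qed.

Let powRX (b e : R) k : 0 < b -> (b ^+ k) `^ e = (b `^ e) ^+ k.
Proof.
move=> b0; rewrite -powR_mulrn; last exact: ltW.
by rewrite -powRrM mulrC powRrM powR_mulrn ?powR_ge0.
Qed.

Let powR_dim (x : R) : 0 < x -> x `^ (- (d%:R + s)) * x ^+ d = x `^ (- s).
Proof.
move=> x0; rewrite -powR_mulrn; last exact: ltW.
have -> : - s = - (d%:R + s) + d%:R by ring.
by rewrite [RHS]powRD// (gt_eqF x0) implybT.
Qed.

(** The ball has 4 times the inner radius x = a / 2^(j+1) of the shell, so the expression is V * 4^d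
    * x^(1-s), which is geometric in j. *)
Let near_termE (a : R) j : 0 < a ->
  (a / 2 ^+ j.+1) `^ (1 - (d%:R + s)) * (V * (2 * (a / 2 ^+ j)) ^+ d) =
  V * 4 ^+ d * q * a `^ (1 - s) * q ^+ j.
Proof.
move=> a0; set x := a / 2 ^+ j.+1; have x0 : 0 < x by rewrite divr_gt0.
have -> : 2 * (a / 2 ^+ j) = 4 * x.
  rewrite /x exprS; have := gt_eqF (pow2 j); move: (2 ^+ j) => u u0; field.
  by rewrite u0.
have xE : x `^ (1 - s) = a `^ (1 - s) * q * q ^+ j.
  rewrite /x -exprVn powRM ?exprn_ge0 ?invr_ge0//; last exact: ltW.
  by rewrite powRX ?invr_gt0// exprS mulrA.
rewrite exprMn powRD ?(gt_eqF x0) ?implybT// powRr1; last exact: ltW.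
transitivity (V * 4 ^+ d * (x * (x `^ (- (d%:R + s)) * x ^+ d))); first by ring.
rewrite powR_dim// -{1}(powRr1 (ltW x0)) -powRD ?(gt_eqF x0) ?implybT// xE.
by ring.
Qed.

Let far_termE (a : R) j : 0 < a ->
  a * (2 ^+ j * a) `^ (- (d%:R + s)) * (V * (2 * (2 ^+ j * a)) ^+ d) =
  V * 2 ^+ d * a `^ (1 - s) * q' ^+ j.
Proof.
move=> a0; set x := 2 ^+ j * a; have x0 : 0 < x by rewrite mulr_gt0.
have xE : x `^ (- s) = q' ^+ j * a `^ (- s).
  by rewrite /x powRM ?exprn_ge0//; [rewrite powRX|exact: ltW].
rewrite exprMn.
transitivity (V * 2 ^+ d * (a * (x `^ (- (d%:R + s)) * x ^+ d))); first by ring.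
rewrite powR_dim// xE powRD ?(gt_eqF a0) ?implybT// powRr1; last exact: ltW.
by ring.
Qed.

Lemma measurable_riesz_min (a : R) (x : X) : measurable_fun setT
  (fun y : X => (riesz s (x - y) * Num.min (enorm (x - y)) a)%:E : \bar R).
Proof.
apply/measurable_EFinP; apply: measurable_funM.
  by apply/measurable_EFinP; exact: measurable_fun_riesz.
apply: measurable_minr; last exact: measurable_cst.
rewrite (_ : (fun y : X => _) = (fun y : X => enorm (y - x))).
  exact: measurable_dist.
by apply/funext => y; rewrite enormC.
Qed.

(** Each y lies in the shell of some index, so the integrand is at most the sum of all shell bounds.
    Integrating that sum term by term leaves two geometric series. *)
Lemma riesz_min_integral_le (a : R) (x : X) : 0 < a ->
  (\int[@leb R n]_y (riesz s (x - y) * Num.min (enorm (x - y)) a)%:E <=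
   (moment_const * a `^ (1 - s))%:E)%E.
Proof.
move=> a0.
have mnear j : measurable_fun setT (fun y : X => (near_term a j x y)%:E : \bar R).
  by apply/measurable_EFinP; apply: measurable_funM; [exact: measurable_cst|exact: m_indic].
have mfar j : measurable_fun setT (fun y : X => (far_term a j x y)%:E : \bar R).
  by apply/measurable_EFinP; apply: measurable_funM; [exact: measurable_cst|exact: m_indic].
have near0 j (y : X) : (0 <= (near_term a j x y)%:E)%E.
  by rewrite lee_fin near_term_ge0.
have far0 j (y : X) : (0 <= (far_term a j x y)%:E)%E.
  by rewrite lee_fin far_term_ge0// ltW.
pose f j (y : X) := ((near_term a j x y)%:E + (far_term a j x y)%:E)%E.
have f0 j y : (0 <= f j y)%E by rewrite adde_ge0.
have mf j : measurable_fun setT (f j) by exact: emeasurable_funD.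
apply: (@le_trans _ _ (\int[@leb R n]_y \sum_(j <oo) f j y)%E).
  apply: (@ge0_le_integral _ X R (@leb R n) _ measurableT).
  - move=> y _; rewrite lee_fin mulr_ge0 ?riesz_ge0//.
    by rewrite le_min enorm_ge0 ltW.
  - exact: measurable_riesz_min.
  - by apply: ge0_emeasurable_sum => // j y _; exact: f0.
  - move=> y _; have [j le_j] := riesz_min_le_terms x y a0.
    apply: le_trans (nneseries_lim_ge j.+1 (fun j _ _ => f0 j y)).
    rewrite big_nat_recr//= -[leLHS]add0e; apply: leeD; last by rewrite /f -EFinD lee_fin.
    by apply: sume_ge0.
rewrite (@integral_nneseries _ X R (@leb R n) _ measurableT f mf (fun j y _ => f0 j y)).
have fE j : (\int[@leb R n]_y f j y =
    (V * 4 ^+ d * q * a `^ (1 - s) * q ^+ j)%:E +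
    (V * 2 ^+ d * a `^ (1 - s) * q' ^+ j)%:E)%E.
  rewrite (@ge0_integralD _ X R (@leb R n) _ measurableT _ _
    (fun y _ => near0 j y) (mnear j) (fun y _ => far0 j y) (mfar j)).
  rewrite -near_termE// -far_termE// -!(integral_indic_eball x)//.
  - by rewrite mulr_ge0 ?powR_ge0// ltW.
  - by rewrite !mulr_gt0.
  - exact: powR_ge0.
  - by rewrite mulr_gt0// divr_gt0.
have cq0 (c r : R) : 0 <= c -> 0 <= r < 1 ->
    forall j, (0 <= j)%N -> true -> (0 <= (c * r ^+ j)%:E)%E.
  by move=> c0 /andP[r0 _] j _ _; rewrite lee_fin mulr_ge0// exprn_ge0.
rewrite (eq_eseriesr (fun j _ => fE j)) nneseriesD.
- rewrite !nneseries_geometric// -EFinD lee_fin /moment_const -/q -/q' le_eqVlt.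
  by apply/orP; left; apply/eqP; ring.
- by apply: cq0 => //; rewrite !mulr_ge0 ?unit_ball_vol_ge0 ?powR_ge0.
- by apply: cq0 => //; rewrite !mulr_ge0 ?unit_ball_vol_ge0 ?powR_ge0 ?exprn_ge0.
Qed.

End kernel_moment.

(** * Averaging over radii the interaction across a sphere *)

Section mean_crossing.
Variables (R : realType) (n : nat) (s : R).
Hypothesis s01 : 0 < s < 1.
Local Notation X := (lebspace R n).
Local Notation T := (measurableTypeR R).
Local Notation L := (interaction s).
Variables (A : set 'rV[R]_n.+1) (p : 'rV[R]_n.+1) (r1 r2 : R).
Hypotheses (mA : lmeasurable A) (r12 : r1 < r2).
Local Open Scope ereal_scope.

Let I : set T := `]r1, r2[%classic.

Let mI : measurable I. Proof. exact: measurable_itv. Qed.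

(** Triples (t, x, y) for which x is in A and the sphere of radius t around p separates x, inside,
    from y, outside. Treating the radius as a third variable makes the integrand [h] jointly
    measurable, as Tonelli requires. *)
Let D : set (T * X * X) :=
  [set z | [/\ A z.1.2, (enorm (z.1.2 - p) < z.1.1)%R & (z.1.1 <= enorm (z.2 - p))%R]].

Let mt : measurable_fun setT (fun z : T * X * X => z.1.1 : R).
Proof. exact: (measurableT_comp measurable_fst measurable_fst). Qed.

Let mx : measurable_fun setT (fun z : T * X * X => z.1.2 : X).
Proof. exact: (measurableT_comp measurable_snd measurable_fst). Qed.

Let m_lt (f g : T * X * X -> R) : measurable_fun setT f -> measurable_fun setT g ->
  measurable [set z | (f z < g z)%R].
Proof.
move=> mf mg; have mtrue : measurable [set true] by [].
have := measurable_fun_ltr mf mg measurableT mtrue.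
by rewrite setTI; congr measurable; apply/seteqP; split => z /=.
Qed.

Let mD : measurable D.
Proof.
have -> : D = (fun z : T * X * X => z.1.2) @^-1` A `&`
    [set z | (enorm (z.1.2 - p) < z.1.1)%R] `\` [set z | (enorm (z.2 - p) < z.1.1)%R].
  apply/seteqP; split => z /=.
    by case=> Az lt_z le_z; split => //; rewrite ltNge le_z.
  by case=> -[Az lt_z] /negP; rewrite -leNgt => le_z.
apply: measurableD; last first.
  apply: m_lt mt; exact: (measurableT_comp (measurable_dist p) measurable_snd).
apply: measurableI; first by have := mx measurableT mA; rewrite setTI.
by apply: m_lt mt; exact: (measurableT_comp (measurable_dist p) mx).
Qed.

Let h : T * X * X -> \bar R := (fun z => (riesz s (z.1.2 - z.2)%R)%:E) \_ D.

Let mh : measurable_fun setT h.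
Proof.
apply/(measurable_restrictT _ mD); apply: measurable_funTS.
apply/measurable_EFinP.
have := measurableT_comp (@measurable_riesz R n s) (measurable_fun_pair mx measurable_snd).
exact.
Qed.

Let h0 z : 0 <= h z.
Proof. by apply: erestrict_ge0 => {}z; rewrite lee_fin riesz_ge0. Qed.

Let interaction_eball t : L (A `&` eball p t) (~` eball p t) =
  \int[@leb R n]_x \int[@leb R n]_y h (t, x, y).
Proof.
rewrite interactionE integral_mkcond; apply: eq_integral => x _.
rewrite patchE; case: ifPn; rewrite ?inE ?notin_setE => Ax.
  rewrite integral_mkcond; apply: eq_integral => y _.
  rewrite /h !patchE; congr (if _ then _ else _); apply/idP/idP; rewrite !inE.
    by move/negP; rewrite -leNgt => le_y; case: Ax.
  by case=> _ _ le_y; apply/negP; rewrite -leNgt.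
rewrite integral0_eq// => y _; rewrite /h patchE; case: ifPn => //.
by rewrite inE => -[Az lt_z _]; exfalso; apply: Ax.
Qed.

Let F (u : T * X) := \int[@leb R n]_y h (u, y).

Let mF : measurable_fun setT F.
Proof. exact: (@measurable_fun_integral_section _ _ (T * X)%type X R (@leb R n) h mh h0 setT). Qed.

Let F0 u : 0 <= F u. Proof. by apply: integral_ge0 => y _; exact: h0. Qed.

Let S := A `&` eball p r2.

Let mS : lmeasurable S. Proof. by apply: measurableI => //; exact: measurable_eball. Qed.

Let mh_t (x y : X) : measurable_fun setT (fun t : T => h (t, x, y)).
Proof.
have := measurableT_comp mh (measurable_fun_pair (measurable_fun_pair
  (@measurable_id _ T setT) (@measurable_cst _ _ T X setT x)) (@measurable_cst _ _ T X setT y)).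
exact.
Qed.

Let mh_ty (x : X) : measurable_fun setT (fun z : T * X => h (z.1, x, z.2)).
Proof.
have := measurableT_comp mh (measurable_fun_pair (measurable_fun_pair
  (@measurable_fst _ _ T X) (@measurable_cst _ _ (T * X)%type X setT x)) (@measurable_snd _ _ T X)).
exact.
Qed.

Let lebesgue_itv : (lebesgue_measure : set T -> \bar R) I = (r2 - r1)%:E.
Proof. by rewrite /I lebesgue_measure_itv/= lte_fin r12 EFinB. Qed.

(** The separating radii lie in the interval [J] from |x - p| to |y - p|, whose length is at most |x
    - y| by the triangle inequality. The other bound is the length of [I]. *)
Let crossing_at (x y : X) : \int[lebesgue_measure]_(t in I) h (t, x, y) <=
  (riesz s (x - y) * Num.min (enorm (x - y)) (r2 - r1))%:E.
Proof.
pose J : set T := `]enorm (x - p)%R, enorm (y - p)%R]%classic.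
have mJ : measurable J by exact: measurable_itv.
have k0 := riesz_ge0 s (x - y).
have mJ' : measurable_fun I (fun t : T => (\1_J t : R)%:E).
  by apply/measurable_funTS/measurable_EFinP; exact: measurable_indic.
apply: (@le_trans _ _ (\int[lebesgue_measure]_(t in I)
    ((riesz s (x - y)%R)%:E * (\1_J t)%:E))).
  apply: (@ge0_le_integral _ T R lebesgue_measure _ mI).
  - by move=> t _; exact: h0.
  - by apply: measurable_funTS; exact: mh_t.
  - exact: (measurable_funeM _ mJ').
  - move=> t _; rewrite /h patchE; case: ifPn; rewrite ?inE => tD.
      case: tD => /= Ax lt_x le_y.
      by rewrite indicE mem_set ?mule1// /J/= in_itv/= lt_x le_y.
    by rewrite mule_ge0 ?lee_fin.
rewrite (@ge0_integralZl _ T R lebesgue_measure _ mI _ mJ'); last 2 first.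
- by move=> t _; rewrite lee_fin.
- by rewrite lee_fin.
rewrite integral_indic// EFinM; apply: lee_wpmul2l; first by rewrite lee_fin.
rewrite EFin_min le_min; apply/andP; split; last first.
  rewrite -lebesgue_itv; apply: le_measure; rewrite ?inE//; exact: measurableI.
apply: (@le_trans _ _ ((lebesgue_measure : set T -> \bar R) J)).
  by apply: le_measure; rewrite ?inE//; exact: measurableI.
rewrite /J lebesgue_measure_itv/= lte_fin; case: ifPn => _.
  by rewrite -EFinB lee_fin lerBlDl enorm_dist.
by rewrite lee_fin enorm_ge0.
Qed.

(* Tonelli: for fixed x and y, the set of radii t in ]r1, r2[ for which the sphere
   of radius t separates x from y has length at most min(|x - y|, r2 - r1), which
   tames the singularity of the kernel. *)
Lemma mean_crossing_le (c : R) : (0 <= c)%R ->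
  (forall t, (r1 < t < r2)%R -> c%:E <= L (A `&` eball p t) (~` eball p t)) ->
  (c * (r2 - r1))%:E <=
    (moment_const n s * (r2 - r1) `^ (1 - s))%:E * leb (A `&` eball p r2 : set X).
Proof.
move=> c0 cL; have a0 : (0 < r2 - r1)%R by rewrite subr_gt0.
set M := (moment_const n s * _)%R.
have mG : measurable_fun setT (fun t : T => \int[@leb R n]_x F (t, x)).
  exact: (@measurable_fun_integral_section _ _ T X R (@leb R n) F mF F0 setT).
apply: (@le_trans _ _ (\int[lebesgue_measure]_(t in I) \int[@leb R n]_x F (t, x))).
  apply: (@le_trans _ _ (\int[lebesgue_measure]_(t in I) cst c%:E t)).
    by rewrite (@integral_cst _ T R lebesgue_measure _ mI) EFinM -lebesgue_itv.
  apply: (@ge0_le_integral _ T R lebesgue_measure _ mI).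
  - by move=> t _; rewrite lee_fin.
  - exact: measurable_cst.
  - exact: measurable_funTS.
  - by move=> t It; rewrite -interaction_eball cL//; move: It; rewrite /I/= in_itv.
rewrite (@fubini_tonelli_rectangle _ _ T X R lebesgue_measure (@leb R n)
  F mF F0 _ _ mI measurableT).
have mF_swap : measurable_fun setT (fun z : X * T => F (z.2, z.1)).
  by have := measurableT_comp mF (@measurable_swap _ _ X T).
(* Only x in [S] contributes, since |x - p| < t < r2. For such x a second exchange makes the
   integral over t the innermost one, where [crossing_at] applies. *)
apply: (@le_trans _ _ (\int[@leb R n]_x ((cst M%:E) \_ S) x)).
  apply: (@ge0_le_integral _ X R (@leb R n) _ measurableT).
  - by move=> x _; apply: integral_ge0 => t _; exact: F0.
  - exact: (@measurable_fun_integral_section _ _ X T R lebesgue_measure _ mF_swap _ I mI).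
  - apply/(measurable_restrictT _ mS); exact: measurable_cst.
  - move=> x _; rewrite patchE; case: ifPn; rewrite ?inE ?notin_setE => Sx.
      rewrite /F (@fubini_tonelli_rectangle _ _ T X R lebesgue_measure (@leb R n)
        _ (mh_ty x) (fun z => h0 (z.1, x, z.2)) _ _ mI measurableT).
      have mh_swap : measurable_fun setT (fun z : X * T => h (z.2, x, z.1)).
        by have := measurableT_comp (mh_ty x) (@measurable_swap _ _ X T).
      apply: le_trans (riesz_min_integral_le s01 x a0).
      apply: (@ge0_le_integral _ X R (@leb R n) _ measurableT).
      + by move=> y _; apply: integral_ge0 => t _; exact: h0.
      + exact: (@measurable_fun_integral_section _ _ X T R lebesgue_measure _ mh_swap _ I mI).
      + exact: measurable_riesz_min.
      + move=> y _; exact: crossing_at.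
    rewrite integral0_eq// => t It. apply: integral0_eq => y _.
    rewrite /h patchE; case: ifPn => //; rewrite inE => -[/= Ax lt_x _].
    exfalso; apply: Sx; split => //; apply: lt_trans lt_x _.
    by move: It; rewrite /I/= in_itv/= => /andP[].
rewrite -(@integral_mkcond _ X R (@leb R n) S (cst M%:E)).
by rewrite (@integral_cst _ X R (@leb R n) _ mS).
Qed.

End mean_crossing.

(** * De Giorgi iteration and the uniform density estimate *)

Section density.
Variables (R : realType) (n : nat) (s : R).
Hypothesis s01 : 0 < s < 1.
Local Notation X := (lebspace R n).
Local Notation L := (interaction s).
Local Notation d := n.+1.
Local Notation V := (unit_ball_vol R n).
Local Notation M := (moment_const n s).

Local Opaque interaction.

Let s0 : 0 < s. Proof. by case/andP: s01. Qed.
Let s1 : s < 1. Proof. by case/andP: s01. Qed.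

Lemma leb_eballI_fin (E : set 'rV[R]_n.+1) p (r : R) : 0 < r ->
  leb (E `&` eball p r : set X) \is a fin_num.
Proof.
move=> r0; rewrite ge0_fin_numE; last exact: outer_measure_ge0.
apply: (@le_lt_trans _ _ (leb (eball p r : set X))).
  by apply: le_outer_measure; exact: subIsetr.
by rewrite leb_eballE// ltry.
Qed.

Lemma moment_const_gt0 : 0 < V -> 0 < M.
Proof.
move=> V0; have p1 (b e : R) : 0 < b -> 0 < e -> b < 1 -> 0 < 1 - b `^ e.
  move=> b0 e0 b1; rewrite subr_gt0 -[ltRHS](congr1 (fun f => f e) (powR1 R)).
  by apply: gt0_ltr_powR; rewrite ?nnegrE// ltW.
have s'0 : 0 < 1 - s by rewrite subr_gt0.
rewrite /moment_const addr_gt0// divr_gt0 ?mulr_gt0 ?exprn_gt0 ?powR_gt0 ?invr_gt0//.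
  by rewrite p1 ?invr_gt0// invf_lt1 ?ltr1n.
rewrite powRN subr_gt0 invf_lt1 ?powR_gt0// -[ltLHS](congr1 (fun f => f s) (powR1 R)).
by apply: gt0_ltr_powR; rewrite ?nnegrE ?ltr1n.
Qed.

(* The isoperimetric bound is used at the scale [lambda * (r2 - r1)], which makes
   the recursion linear. *)
Lemma density_step (E Omega : set 'rV[R]_n.+1) p (r1 r2 lambda : R) :
  0 < V -> lmeasurable Omega -> sminimal s E Omega -> eball p r2 `<=` Omega ->
  0 < r1 -> r1 < r2 -> 0 < lambda ->
  fine (leb (E `&` eball p r2 : set X)) <= V / 2 * (lambda * (r2 - r1)) ^+ d ->
  fine (leb (E `&` eball p r1 : set X)) <=
    4 * M / V * lambda `^ s * fine (leb (E `&` eball p r2 : set X)).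
Proof.
move=> V0 mO minE BO r10 r12 lambda0 small.
have mE : lmeasurable E by case: minE.
have a0 : 0 < r2 - r1 by rewrite subr_gt0.
have r20 : 0 < r2 by exact: lt_trans r12.
set u1 := fine (leb (E `&` eball p r1 : set X)).
set u2 := fine (leb (E `&` eball p r2 : set X)).
set rho := lambda * (r2 - r1).
have rho0 : 0 < rho by rewrite mulr_gt0.
have u10 : 0 <= u1 by apply: fine_ge0; exact: outer_measure_ge0.
(* Half of the isoperimetric bound, with |E & B_t| replaced by the smaller |E & B_r1| so that [c]
   does not depend on t. *)
pose c := V / 2 * rho `^ (- s) * u1 / 2.
have c0 : 0 <= c by rewrite !mulr_ge0 ?powR_ge0 ?(ltW V0) ?invr_ge0.
have cL t : r1 < t < r2 -> (c%:E <= L (E `&` eball p t) (~` eball p t))%E.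
  move=> /andP[r1t tr2]; set A := E `&` eball p t.
  have mB : lmeasurable (eball p t) by exact: measurable_eball.
  have mA : lmeasurable A by exact: measurableI.
  have Br2 : eball p t `<=` eball p r2 by move=> y yt; exact: lt_trans tr2.
  have AEO : A `<=` E `&` Omega by move=> y [Ey /Br2/BO].
  have mC : lmeasurable (~` A) by exact: measurableC.
  have mCE : lmeasurable (~` E) by exact: measurableC.
  have mEA : lmeasurable (E `\` A) by exact: measurableD.
  have mCB : lmeasurable (~` eball p t) by exact: measurableC.
  (* The complement of A consists of ~E and E \ A. The latter lies outside B_t, and minimality
     bounds the interaction of A with ~E by that with E \ A. *)
  have split_le : (L A (~` A) <= L A (~` eball p t) + L A (~` eball p t))%E.
    have -> : ~` A = ~` E `|` E `\` A.
      apply/seteqP; split => y /=.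
        by move=> Ay; have [Ey|Ey] := pselect (E y); [right|left].
      by case=> [Ey [/Ey]|[]].
    rewrite (interactionUr s mA mCE mEA); last by apply/seteqP; split => // y [Ey [/Ey]].
    have EAB : (L A (E `\` A) <= L A (~` eball p t))%E.
      by apply: interactionSr => // y [Ey Ay] yt; apply: Ay.
    apply: (leeD _ EAB); apply: (le_trans _ EAB); exact: (sminimal_subset_le mO).
  have lower : ((V / 2 * rho `^ (- s))%:E * leb (A : set X) <= L A (~` A))%E.
    apply: interaction_compl_ge => //.
    apply: le_trans (_ : _ <= (leb (E `&` eball p r2 : set X)))%E _.
      by apply: le_outer_measure; exact: setIS.
    by rewrite -(fineK (leb_eballI_fin E p r20)) lee_fin.
  have u1A : (u1%:E <= leb (A : set X))%E.
    rewrite fineK ?leb_eballI_fin//; apply: le_outer_measure; apply: setIS.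
    by move=> y yt; exact: lt_trans r1t.
  have : ((V / 2 * rho `^ (- s) * u1)%:E <=
      L A (~` eball p t) + L A (~` eball p t))%E.
    apply: le_trans split_le; apply: le_trans lower.
    rewrite EFinM; apply: lee_wpmul2l => //.
    by rewrite lee_fin !mulr_ge0 ?powR_ge0 ?(ltW V0) ?invr_ge0.
  move: (interaction_ge0 s A (~` eball p t)).
  case: (L A (~` eball p t)) => [l| |]//=; last by move=> _ _; rewrite leey.
  by rewrite /c -EFinD !lee_fin => l0; lra.
have := mean_crossing_le s01 mE r12 c0 cL.
rewrite -(fineK (leb_eballI_fin E p r20)) -/u2 -EFinM lee_fin.
have -> : (r2 - r1) `^ (1 - s) = (r2 - r1) * (r2 - r1) `^ (- s).
  by rewrite powRD ?(gt_eqF a0) ?implybT// powRr1// ltW.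
rewrite /c /rho (powRM _ (ltW lambda0) (ltW a0)) !powRN.
have as0 : 0 < (r2 - r1) `^ s by rewrite powR_gt0.
have ls0 : 0 < lambda `^ s by rewrite powR_gt0.
move: as0 ls0; move: ((r2 - r1) `^ s) (lambda `^ s) => w l w0 l0 le12.
(* This is the coefficient of [u1] in [le12]. Dividing by it cancels both r2 - r1 and its power w,
   so that only l = lambda^s remains. *)
have k0 : 0 < V * (r2 - r1) / (4 * l * w) by rewrite divr_gt0 ?mulr_gt0.
rewrite -(ler_pM2l k0); apply: le_trans (le_trans _ le12) _.
  rewrite le_eqVlt; apply/orP; left; apply/eqP; field.
  by rewrite !gt_eqF.
rewrite le_eqVlt; apply/orP; left; apply/eqP; field.
by rewrite !gt_eqF.
Qed.

Lemma density_estimate (r : R) : 0 < r -> exists2 delta : R, 0 < delta &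
  forall (E Omega : set 'rV[R]_n.+1) p,
  lmeasurable Omega -> sminimal s E Omega -> eball p r `<=` Omega ->
  (forall rho : R, 0 < rho -> (0 < leb (E `&` eball p rho : set X))%E) ->
  (delta%:E <= leb (E `&` eball p r : set X))%E.
Proof.
move=> r0; have [V0|V0] := ltP 0 V; last first.
  (* If V were not positive, the ball of radius r would be null, against the positivity assumed of
     E; any delta will do. *)
  exists 1 => // E Omega p _ _ _ /(_ r r0).
  suff -> : leb (E `&` eball p r : set X) = 0%E by rewrite ltxx.
  apply/eqP; rewrite eq_le outer_measure_ge0 andbT.
  apply: (@le_trans _ _ (leb (eball p r : set X))).
    by apply: le_outer_measure; exact: subIsetr.
  by rewrite leb_eballE// lee_fin mulr_le0_ge0// exprn_ge0 ?ltW.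
have M0 := moment_const_gt0 V0.
(* With this [lambda] the volume in the balls of radius [rk k] shrinks by the
   factor 2^-d at each step as soon as it starts below [delta], whereas it is
   bounded below by the volume in the ball of radius r / 2. *)
pose lambda := (V / (4 * M * 2 ^+ d)) `^ s^-1.
have vM0 : 0 < V / (4 * M * 2 ^+ d) by rewrite divr_gt0 ?mulr_gt0 ?exprn_gt0.
have lambda0 : 0 < lambda by rewrite powR_gt0.
have lambdaE : 4 * M / V * lambda `^ s = (2^-1) ^+ d.
  rewrite /lambda -powRrM mulVf ?gt_eqF// powRr1 ?ltW// exprVn.
  have : 2 ^+ d != 0 :> R by rewrite expf_neq0.
  move: (2 ^+ d) => w w0; field.
  by rewrite w0 !gt_eqF.
(* The smallness threshold of [density_step] for the first two radii, which differ by r / 4. For the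
   k-th pair the gap is 2^-k times as large and the threshold is delta * 2^(-kd), exactly the bound
   that the induction in [decay] propagates. *)
pose delta := V / 2 * (lambda * (r / 4)) ^+ d.
have delta0 : 0 < delta by rewrite mulr_gt0 ?divr_gt0 ?exprn_gt0 ?mulr_gt0 ?divr_gt0.
exists delta => // E Omega p mO minE BO E_pos.
rewrite leNgt; apply/negP => small.
pose rk (k : nat) := r / 2 + r / 2 * 2^-1 ^+ k.
pose u (t : R) := fine (leb (E `&` eball p t : set X)).
have hk k : 0 < 2^-1 ^+ k :> R by rewrite exprn_gt0.
have r20 : 0 < r / 2 by rewrite divr_gt0.
have rk_gt k : r / 2 < rk k by rewrite ltrDl mulr_gt0.
have rk0 k : 0 < rk k by rewrite (lt_trans r20).
have rkS k : rk k - rk k.+1 = r / 4 * 2^-1 ^+ k.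
  by rewrite /rk exprS; field.
have rk_le k : rk k <= r.
  have : 2^-1 ^+ k <= 1 :> R by rewrite exprn_ile1// invf_le1 ?ler1n.
  rewrite -(ler_pM2l r20) /rk; lra.
have decay k : u (rk k) <= delta * (2^-1 ^+ k) ^+ d.
  elim: k => [|k IHk].
    have -> : rk 0 = r by rewrite /rk expr0; field.
    rewrite expr0 expr1n mulr1 -lee_fin fineK ?leb_eballI_fin//; exact: ltW.
  have rkk : rk k.+1 < rk k by rewrite -subr_gt0 rkS mulr_gt0 ?divr_gt0.
  have BkO : eball p (rk k) `<=` Omega.
    by move=> y yk; apply: BO; exact: lt_le_trans (rk_le k).
  have := density_step V0 mO minE BkO (rk0 _) rkk lambda0.
  rewrite lambdaE rkS -/(u (rk k)) -/(u (rk k.+1)).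
  have -> : V / 2 * (lambda * (r / 4 * 2^-1 ^+ k)) ^+ d = delta * (2^-1 ^+ k) ^+ d.
    by rewrite /delta [lambda * (r / 4 * _)]mulrA [in LHS]exprMn [LHS]mulrA.
  move=> /(_ IHk) /le_trans; apply.
  by rewrite [2^-1 ^+ k.+1]exprS exprMn mulrCA ler_pM2l ?exprn_gt0.
have u0 : 0 < u (r / 2).
  by apply: fine_gt0; rewrite E_pos//= -ge0_fin_numE ?leb_eballI_fin// outer_measure_ge0.
have u_le k : u (r / 2) <= delta * 2^-1 ^+ k.
  apply: (@le_trans _ _ (u (rk k))).
    apply: fine_le; rewrite ?leb_eballI_fin//.
    by apply: le_outer_measure; apply: setIS => y yr; exact: lt_trans (rk_gt k).
  apply: le_trans (decay k) _; rewrite ler_pM2l// exprS.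
  rewrite ger_pMr// -exprM exprn_ile1//.
  by rewrite invf_le1 ?ler1n.
(* For this k, 2^k exceeds delta / u(r / 2), which contradicts [u_le]. *)
pose k := Num.truncn (delta / u (r / 2)).
have : delta / u (r / 2) < 2 ^+ k.
  rewrite (lt_le_trans (truncnS_gt _))// -natrX ler_nat.
  exact: ltn_expl.
rewrite ltr_pdivrMr// mulrC -ltr_pdivrMr ?exprn_gt0// -exprVn => /lt_le_trans.
by move=> /(_ _ (u_le k)); rewrite ltxx.
Qed.

End density.

(** * Euclidean balls, compact sets and topological boundaries *)

Section topology.
Variables (R : realType) (n : nat).
Implicit Types (x y : 'rV[R]_n.+1) (E K : set 'rV[R]_n.+1).

Lemma eball_sub_ball x (r : R) : 0 < r -> eball x r `<=` ball x r.
Proof.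
move=> r0 y yr; split => // i j; rewrite (ord1 i) /ball/= distrC.
by apply: le_lt_trans yr; have := ler_coord_enorm (y - x) j; rewrite !mxE.
Qed.

(** Near each point of K, half of an admissible radius serves all close points; compactness, as a
    near-covering property, makes the choice uniform. *)
Lemma compact_sub_open_eball K Omega : compact K -> open Omega -> K `<=` Omega ->
  exists2 r : R, 0 < r & forall x, K x -> eball x r `<=` Omega.
Proof.
move=> /compact_near_coveringP cK oO KO.
have : \forall r \near (0 : R)^'+, K `<=` (fun x => ball x r `<=` Omega).
  apply: cK => x /KO Ox.
  have /nbhs_ballP[e /= e0 xeO] : nbhs x Omega by exact: open_nbhs_nbhs.
  exists (ball x (e / 2), [set r | r < e / 2]).
    split; first by apply: nbhsx_ballx; rewrite divr_gt0.
    by apply: nbhs_right_lt; rewrite divr_gt0.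
  move=> [y r] /= [xy re] z yz; apply: xeO; rewrite [e]splitr.
  exact: ball_triangle xy (le_ball (ltW re) yz).
move=> Kr; near (0 : R)^'+ => r.
have r0 : 0 < r by near: r; exact: nbhs_right_gt.
exists r => // x Kx; apply: subset_trans (eball_sub_ball _) _ => //.
by move: x Kx; near: r.
Unshelve. all: by end_near. Qed.

(** Convergence in measure is only local. A single compact set that contains all the balls makes it
    uniform in their centers. *)
Lemma compact_eball_cover K (r : R) : compact K -> 0 < r ->
  exists2 K' : set 'rV[R]_n.+1, compact K' & forall x, K x -> eball x r `<=` K'.
Proof.
move=> cK r0; have [N [_ KN]] := compact_bounded cK.
pose b := N + 1 + r.
exists [set v : 'rV[R]_n.+1 | forall i, v ord0 i \in `[- b, b]].
  by apply: (@rV_compact _ _ (fun=> `[- b, b]%classic)) => _; exact: segment_compact.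
move=> x Kx y yr i; have := KN (N + 1); rewrite ltrDl ltr01 => /(_ isT x Kx) xN.
have xi : `|x ord0 i| <= N + 1.
  apply: le_trans xN; rewrite [leRHS]/Num.norm/= mx_normrE; apply/bigmax_geP; right.
  by exists (ord0, i).
have yi := le_lt_trans (ler_coord_enorm (y - x) i) yr; rewrite !mxE in yi.
rewrite /= in_itv/= -ler_norml -[y ord0 i](subrK (x ord0 i)).
by rewrite (le_trans (ler_normD _ _))// addrC lerD// ltW.
Qed.

(** On a segment from x to a point of the ball, being in E, in its closure or in its interior all
    amount to the same. The trace of E on the segment is thus open and closed, and connectedness
    puts both endpoints in E or neither. *)
Lemma eball_bdry_dichotomy E x (r : R) : eball x r `&` bdry E = set0 ->
  eball x r `<=` E \/ eball x r `<=` ~` E.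
Proof.
move=> xrE.
have key y : eball x r y -> E x \/ E y -> E x /\ E y.
  move=> yr Exy.
  pose f (t : R) := x + t *: (y - x).
  pose C := [set f t | t in `[0, 1]].
  have cC : connected C.
    apply: connected_continuous_connected; first exact: segment_connected.
    apply: continuous_subspaceT => t; apply: cvgD; first exact: cvg_cst.
    by apply: cvgZr_tmp; exact: cvg_id.
  have f0 : f 0 = x by rewrite /f scale0r addr0.
  have f1 : f 1 = y by rewrite /f scale1r addrC subrK.
  have Cx : C x by exists 0 => //; rewrite /= in_itv/= lexx ler01.
  have Cy : C y by exists 1 => //; rewrite /= in_itv/= lexx ler01.
  have Cr : C `<=` eball x r.
    move=> _ [t t01 <-]; rewrite /eball /f/= addrAC subrr add0r enormZ.
    move: t01; rewrite /= in_itv/= => /andP[t0 t1]; rewrite ger0_norm//.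
    by apply: le_lt_trans yr; rewrite ler_piMl// enorm_ge0.
  have Eint z : C z -> closure E z -> E° z.
    move=> /Cr zr clz; apply: contrapT => nEz.
    by have : (eball x r `&` bdry E) z by []; rewrite xrE.
  have CE : C `&` E° = C.
    apply: cC.
    - case: Exy => [Ex|Ey]; [exists x|exists y]; split => //; apply: Eint => //;
        exact: subset_closure.
    - by exists E°; [exact: open_interior|].
    - exists (closure E); first exact: closed_closure.
      apply/seteqP; split => z [Cz Ez]; split => //; last exact: Eint.
      exact: (subset_closure (interior_subset Ez)).
  by split; apply: interior_subset; [move: Cx|move: Cy]; rewrite -CE => -[].
have [Ex|Ex] := pselect (E x); [left|right] => y yr.
  by have [] := key y yr (or_introl Ex).
by move=> Ey; have [] := key y yr (or_intror Ey).
Qed.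

End topology.

(** * Uniform convergence of boundaries on compact sets *)

Lemma near_infty_leb_lt (R : realType) (n : nat) (Ek : nat -> set 'rV[R]_n.+1) E K
    (delta : R) : cvg_locally_in_measure Ek E -> compact K -> 0 < delta ->
  exists n0 : nat, forall k, (n0 <= k)%N ->
    (lebesgue_outer ((Ek k `+` E) `&` K) < delta%:E)%E.
Proof.
move=> EkE cK d0; have lt_delta : nbhs (0%E : \bar R) [set z | (z < delta%:E)%E].
  by apply: open_nbhs_nbhs; split; [exact: open_ereal_lt_ereal|rewrite /= lte_fin].
by have [n0 _ n0P] := EkE K cK _ lt_delta; exists n0.
Qed.

Theorem corollary3p19 (R : realType) (n : nat) (s : R)
    (Omega : set 'rV[R]_n.+1)
    (Ek : nat -> set 'rV[R]_n.+1) (E : set 'rV[R]_n.+1) :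
  0 < s < 1 ->
  open Omega ->
  (forall k, normalized (Ek k)) ->
  (forall k, sminimal s (Ek k) Omega) ->
  lmeasurable E ->
  normalized E ->
  cvg_locally_in_measure Ek E ->
  forall K : set 'rV[R]_n.+1, compact K -> K `<=` Omega ->
  forall eps : R, 0 < eps ->
  exists n0 : nat, forall k : nat, (n0 <= k)%N ->
    bdry (Ek k) `&` K `<=` nbhd eps (bdry E) `&` K.
Proof.
move=> s01 oO Ek_norm Ek_min _ _ EkE K cK KO eps eps0.
have mO : lmeasurable Omega by exact: open_lmeasurable.
have [r1 r10 r1O] := compact_sub_open_eball cK oO KO.
(* The bound r1 keeps the balls inside Omega; the bound eps ensures that a ball around a point far
   from the boundary of E does not meet it. *)
pose r := Num.min r1 eps.
have r0 : 0 < r by rewrite lt_min r10.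
have rO x : K x -> eball x r `<=` Omega.
  by move=> /r1O; apply: subset_trans => y /lt_le_trans; apply; rewrite ge_min lexx.
(* Since [delta] is chosen before k and x, the index [n0] below serves all points of K. *)
have [delta delta0 density] := density_estimate n s01 r0.
have [K' cK' KK'] := compact_eball_cover cK r0.
have [n0 n0P] := near_infty_leb_lt EkE cK' delta0.
exists n0 => k n0k x [xEk Kx]; split => //; apply: contrapT => far.
have xrE : eball x r `&` bdry E = set0.
  apply/seteqP; split => // y [xy yE]; apply: far.
  apply: le_lt_trans (_ : _ <= (enorm (x - y))%:E)%E _.
    by apply: ereal_inf_lbound; exists y.
  by rewrite lte_fin enormC (lt_le_trans xy)// ge_min lexx orbT.
have [_ _ bdryEk] := Ek_norm k.
have xEk' rho : 0 < rho ->
    (0 < lebesgue_outer (Ek k `&` eball x rho) < ball_vol n rho)%E.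
  by move: xEk; rewrite bdryEk; exact.
have := n0P k n0k; rewrite ltNge => /negP; apply.
have [xE|xE] := eball_bdry_dichotomy xrE.
  apply: (@le_trans _ _ (lebesgue_outer (~` Ek k `&` eball x r))).
    apply: (density _ _ _ mO (sminimalC mO (Ek_min k)) (rO x Kx)) => rho rho0.
    (* If the complement of E_k were null in the ball, E_k would have the full volume of the ball
       there, against the strict upper bound that normalization gives at boundary points. *)
    rewrite lt_neqAle outer_measure_ge0 andbT eq_sym; apply/negP => /eqP leb0.
    have /andP[_] := xEk' rho rho0; rewrite ltNge => /negP; apply.
    rewrite -(leb_eball x rho0) -[leRHS]adde0 -leb0 (setIC (Ek k)) (setIC (~` _)).
    exact: le_outer_measureIC.
  apply: le_outer_measure => y [Eky yr]; split; last exact: (KK' x).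
  by right; split => //; exact: xE.
apply: (@le_trans _ _ (lebesgue_outer (Ek k `&` eball x r))).
  apply: (density _ _ _ mO (Ek_min k) (rO x Kx)) => rho rho0.
  by have /andP[] := xEk' rho rho0.
apply: le_outer_measure => y [Eky yr]; split; last exact: (KK' x).
by left; split => //; exact: xE.
Qed.
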